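(* For every constant $c$ with $1\leq c<d_3^{-}$, the complex $\mathrm{Hom}(G(n,c/n),K_3)$ is disconnected with probability tending to $1$ as $n\to\infty$.
   Context: $G(n,p)$ is the Erdős–Rényi random graph on $n$ vertices with each edge present independently with probability $p$; $K_3$ is the triangle. By Achlioptas–Friedgut there is a sequence $d_3(n)$ such that for every $\epsilon>0$: if $c<(1-\epsilon)d_3(n)$ then $\Pr[\chi(G(n,c/n))\le 3]\to 1$, and if $c>(1+\epsilon)d_3(n)$ then $\Pr[\chi(G(n,c/n))\ge 4]\to1$; $d_3^-:=\liminf_{n\to\infty}d_3(n)$. For graphs $G,H$, $\mathrm{Hom}(G,H)$ is the polyhedral complex whose cells are functions $\eta:V(G)\to 2^{V(H)}\setminus\{\varnothing\}$ with $\eta(x)\times\eta(y)\subseteq E(H)$ whenever $\{x,y\}\in E(G)$; the cell $\eta$ is a product of simplices of dimension $\sum_v(|\eta(v)|-1)$, with face relation $\eta\subseteq\tau$ iff $\eta(v)\subseteq\tau(v)$. Disconnected means nonempty with more than one path component. *)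

(* Defs.v *)
From HB Require Import structures.
From mathcomp Require Import all_boot all_order all_algebra.
From mathcomp Require Import all_classical all_reals all_analysis.
Set Implicit Arguments. Unset Strict Implicit. Unset Printing Implicit Defensive.
Import Order.TTheory GRing.Theory Num.Theory.
Import numFieldNormedType.Exports.
Local Open Scope ring_scope.
Local Open Scope classical_set_scope.

(* A graph on 'I_n is a set E of pairs (i,j) with i < j (one per edge). *)
Definition pairs (n : nat) : {set 'I_n * 'I_n} := [set ij : 'I_n * 'I_n | (val ij.1 < val ij.2)%N].

Definition adj (n : nat) (E : {set 'I_n * 'I_n}) : rel 'I_n :=
  fun x y => ((x, y) \in E) || ((y, x) \in E).

(* Pr[G(n,p) has property P]: each of the #|pairs n| possible edges present
   independently with probability p. *)
Definition gnp_prob (R : realType) (n : nat) (p : R)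
    (P : pred {set 'I_n * 'I_n}) : R :=
  \sum_(E in finset.powerset (pairs n) | P E)
     p ^+ #|E| * (1 - p) ^+ (#|pairs n| - #|E|).
Arguments gnp_prob {R} n p P.

Definition colorable (k n : nat) (E : {set 'I_n * 'I_n}) : bool :=
  [exists f : {ffun 'I_n -> 'I_k},
     [forall x, forall y, adj E x y ==> (f x != f y)]].

Section Hom.
Variables (V W : finType) (g : rel V) (h : rel W).

Definition hom_cell (eta : {ffun V -> {set W}}) : bool :=
  [forall x, eta x != finset.set0] &&
  [forall x, forall y, g x y ==>
     [forall a in eta x, forall b in eta y, h a b]].

Definition hom_face (eta tau : {ffun V -> {set W}}) : bool :=
  [forall v, eta v \subset tau v].

Definition hom_incident : rel {ffun V -> {set W}} :=
  fun eta tau => [&& hom_cell eta, hom_cell tau &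
                     hom_face eta tau || hom_face tau eta].

(* Hom(G,H) disconnected: nonempty with more than one path component, i.e.
   there are two cells not joined by a chain of incident cells. *)
Definition hom_disconnected : bool :=
  [exists eta, exists tau,
     [&& hom_cell eta, hom_cell tau & ~~ connect hom_incident eta tau]].
End Hom.

Definition K3 : rel 'I_3 := fun a b => a != b.

Definition eventually_P (P : nat -> Prop) : Prop :=
  exists N, forall n, (N <= n)%N -> P n.
Definition sharp_threshold3 (R : realType) (d : nat -> R) : Prop :=
  forall eps : R, 0 < eps -> forall c : R, 0 < c ->
    ((eventually_P (fun n => c < (1 - eps) * d n)) ->
       (fun n : nat => gnp_prob n (c / n%:R) (fun E => colorable 3 E)) @ \oo --> (1 : R)) /\
    ((eventually_P (fun n => (1 + eps) * d n < c)) ->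
       (fun n : nat => gnp_prob n (c / n%:R) (fun E => ~~ colorable 3 E))
         @ \oo --> (1 : R)).

(* Main.v *)
(* For a 3-colouring f and a closed walk s, count the steps of f along s on the
   triangle with signs. This winding number does not change when f moves inside a
   cell of Hom(G, K3), so it is constant on path components. Exchanging two colours
   negates it, and it is odd, hence nonzero, when s has odd length. So Hom(G, K3) is
   disconnected as soon as G is 3-colourable and contains an odd cycle.

   It remains to see that G(n, c/n) contains an odd cycle with high probability when
   c >= 1. Weight each injective k-cycle by c^-k/k and sum over odd k up to a fixed
   bound: the mean tends to H, the sum of the 1/k, while the variance is at most
   2 H + O(1/n). By Chebyshev the probability of having no odd cycle is O(1/H), and
   H is arbitrarily large because the harmonic series diverges. *)

Require Import Defs.
From HB Require Import structures.
From mathcomp Require Import all_boot all_order all_algebra.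
From mathcomp Require Import zify ring lra.
Set Implicit Arguments. Unset Strict Implicit. Unset Printing Implicit Defensive.
Import Order.TTheory GRing.Theory Num.Theory.
Local Open Scope ring_scope.

(** * Winding numbers *)

(* The step from a to b on the oriented triangle; junk value 0 when a = b. *)
Definition turn (a b : 'I_3) : int :=
  if val a == val b then 0 else if ((val a).+1 %% 3 == val b)%N then 1 else -1.

(** With only three colours, [a] and [a'] can both avoid [b] and [b'] only if [a = a'] or [b = b'];
    a finite check remains. The right-hand side telescopes along a closed walk. *)
Lemma turn_sub (a a' b b' : 'I_3) :
  a != b -> a != b' -> a' != b -> a' != b' ->
  turn a' b' - turn a b = 2 * (turn a a' - turn b b').
Proof.
rewrite -!val_eqE /turn; case: a a' b b' => [a la] [a' la'] [b lb] [b' lb'] /=.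
by case: a la => [|[|[|//]]] _; case: a' la' => [|[|[|//]]] _;
   case: b lb => [|[|[|//]]] _; case: b' lb' => [|[|[|//]]] _.
Qed.

Lemma turn_rev (a b : 'I_3) : turn (rev_ord a) (rev_ord b) = - turn a b.
Proof.
rewrite /turn; case: a b => [a la] [b lb] /=.
by case: a la => [|[|[|//]]] _; case: b lb => [|[|[|//]]] _.
Qed.

Lemma odd_turn (a b : 'I_3) : a != b -> odd `|turn a b|.
Proof.
rewrite -val_eqE /turn; case: a b => [a la] [b lb] /=.
by case: a la => [|[|[|//]]] _; case: b lb => [|[|[|//]]] _.
Qed.

Lemma odd_absz_sum (I : finType) (F : I -> int) :
  (forall i, odd `|F i|) -> odd `|\sum_i F i| = odd #|I|.
Proof.
move=> oddF; have oddD (x y : int) : odd `|x + y| = odd `|x| (+) odd `|y|.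
  by case: x y => x [] y; lia.
rewrite (big_morph (fun x => odd `|x|) oddD (erefl _)).
rewrite (eq_bigr (fun=> true)) => [|i _]; last exact: oddF.
by rewrite big_const; elim: #|I| => //= n ->; case: odd.
Qed.

Section Winding.
Variables (V : finType) (g : rel V) (k : nat) (s : 'I_k -> V).
Hypothesis walk_s : forall i, g (s i) (s (ordS i)).

(** When [f] is proper along the walk, this is three times the degree of the induced closed walk on
    the triangle. *)
Definition winding (f : V -> 'I_3) : int :=
  \sum_i turn (f (s i)) (f (s (ordS i))).

Lemma winding_cell (tau : {ffun V -> {set 'I_3}}) (f f' : V -> 'I_3) :
  hom_cell g K3 tau -> (forall x, f x \in tau x) -> (forall x, f' x \in tau x) ->
  winding f = winding f'.
Proof.
case/andP=> _ /forallP cell_tau tau_f tau_f'.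
have sep x y a b : g x y -> a \in tau x -> b \in tau y -> a != b.
  move=> gxy xa yb; move: (cell_tau x) => /forallP/(_ y)/implyP/(_ gxy).
  by move=> /forallP/(_ a)/implyP/(_ xa)/forallP/(_ b)/implyP/(_ yb).
apply/eqP; rewrite eq_sym -subr_eq0 /winding -sumrB; apply/eqP.
have diff i : turn (f' (s i)) (f' (s (ordS i))) - turn (f (s i)) (f (s (ordS i))) =
    2 * (turn (f (s i)) (f' (s i)) - turn (f (s (ordS i))) (f' (s (ordS i)))).
  by apply: turn_sub; apply: (sep _ _ _ _ (walk_s i)).
rewrite (eq_bigr _ (fun i _ => diff i)).
(* The rotation [ordS] permutes the indices, so the two sums of turns cancel. *)
rewrite -mulr_sumr sumrB [X in _ - X](_ : _ = \sum_i turn (f (s i)) (f' (s i))).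
  by rewrite subrr mulr0.
by rewrite [RHS](reindex (@ordS k)) //; apply: onW_bij; exact: ordS_bij.
Qed.

(** A vertex of the cell [eta]. The default [ord0] is taken only where [eta x] is empty, which a
    cell excludes. *)
Definition cell_rep (eta : {ffun V -> {set 'I_3}}) (x : V) : 'I_3 :=
  odflt ord0 [pick a in eta x].

Lemma mem_cell_rep eta x : hom_cell g K3 eta -> cell_rep eta x \in eta x.
Proof.
case/andP=> /forallP/(_ x)/set0Pn[a xa] _; rewrite /cell_rep.
by case: pickP => [//|/(_ a)]; rewrite xa.
Qed.

(** The representatives of two incident cells both lie in the larger cell, where [winding_cell]
    applies. *)
Lemma winding_connect eta tau : connect (hom_incident g K3) eta tau ->
  winding (cell_rep eta) = winding (cell_rep tau).
Proof.
pose a := [pred eta' | winding (cell_rep eta) == winding (cell_rep eta')].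
have cl_a : closed (hom_incident g K3) a.
  move=> x y /and3P[cx cy]; rewrite !inE => xy.
  suff -> : winding (cell_rep x) = winding (cell_rep y) by [].
  case/orP: xy => /forallP sub.
    by apply: (winding_cell cy) => v; first apply: (subsetP (sub v)); exact: mem_cell_rep.
  by apply: (winding_cell cx) => v; last apply: (subsetP (sub v)); exact: mem_cell_rep.
by move/(closed_connect cl_a); rewrite !inE eqxx => /esym/eqP.
Qed.

(* Exchanging two colours negates the winding number, which is odd. *)
Lemma hom_disconnected_odd_walk (f : V -> 'I_3) :
  odd k -> (forall x y, g x y -> f x != f y) -> hom_disconnected g K3.
Proof.
move=> odd_k col_f.
pose pt (h : V -> 'I_3) : {ffun V -> {set 'I_3}} := [ffun x => [set h x]].
have cell_pt (h : V -> 'I_3) : (forall x y, g x y -> h x != h y) -> hom_cell g K3 (pt h).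
  move=> col_h; apply/andP; split.
    by apply/forallP=> x; rewrite ffunE; apply/set0Pn; exists (h x); rewrite set11.
  apply/forallP=> x; apply/forallP=> y; apply/implyP=> gxy.
  apply/forallP=> a; apply/implyP; rewrite ffunE => /set1P->.
  apply/forallP=> b; apply/implyP; rewrite ffunE => /set1P->.
  exact: col_h.
have rep_pt (h : V -> 'I_3) : (forall x y, g x y -> h x != h y) ->
    winding (cell_rep (pt h)) = winding h.
  move=> col_h; apply: eq_bigr => i _.
  have rep x : cell_rep (pt h) x = h x.
    by have := mem_cell_rep x (cell_pt _ col_h); rewrite ffunE => /set1P.
  by rewrite !rep.
(* [rev_ord] swaps the colours 0 and 2 and fixes 1. *)
pose f' x := rev_ord (f x).
have col_f' x y : g x y -> f' x != f' y by rewrite (inj_eq rev_ord_inj); exact: col_f.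
apply/existsP; exists (pt f); apply/existsP; exists (pt f').
rewrite !cell_pt //=; apply/negP => /winding_connect; rewrite !rep_pt //.
have -> : winding f' = - winding f.
  by rewrite /winding -sumrN; apply: eq_bigr => i _; rewrite turn_rev.
have : odd `|winding f|.
  by rewrite odd_absz_sum ?card_ord // => i; apply: odd_turn; apply: col_f.
by case: (winding f) => n; lia.
Qed.
End Winding.

(** * Cycles as edge sets *)

Lemma val_iter_ordS k (i : 'I_k) m : iter m (@ordS k) i = ((i + m) %% k)%N :> nat.
Proof.
elim: m => [|m IHm] /=; first by rewrite addn0 modn_small.
by rewrite IHm -addn1 modnDml addn1 addnS.
Qed.

Lemma ordS_ind k (P : pred 'I_k) i :
  P i -> (forall j, P j -> P (ordS j)) -> forall j, P j.
Proof.
(* The summand [k] keeps the subtraction from truncating when [j < i]. *)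
move=> Pi PS j; have -> : j = iter (j + k - i)%N (@ordS k) i.
  apply: val_inj; rewrite /= val_iter_ordS subnKC ?modnDr ?modn_small //.
  by have := ltn_ord i; lia.
by elim: (_ - i)%N => //= m; exact: PS.
Qed.

Lemma iter_ordS_neq k (i : 'I_k) m : (0 < m < k)%N -> iter m (@ordS k) i != i.
Proof.
case/andP=> m_gt0 lt_mk; apply/eqP=> eq_i.
have : (i + 0 == i + m %[mod k])%N.
  by rewrite addn0 modn_small // -val_iter_ordS eq_i.
by rewrite eqn_modDl mod0n modn_small // eq_sym; case: m m_gt0 {lt_mk eq_i}.
Qed.

Lemma ordS2_neq k (i : 'I_k) : (2 < k)%N -> ordS (ordS i) != i.
Proof. by move=> k_gt2; apply: (iter_ordS_neq i (m := 2)). Qed.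

Lemma ordS_neq k (i : 'I_k) : (1 < k)%N -> ordS i != i.
Proof. by move=> k_gt1; apply: (iter_ordS_neq i (m := 1)). Qed.

Section Edges.
Variable n : nat.
Implicit Types (x y : 'I_n) (E : {set 'I_n * 'I_n}).

Definition edge x y := if (x < y)%N then (x, y) else (y, x).

Lemma edge_inj x y x' y' : edge x y = edge x' y' ->
  (x = x' /\ y = y') \/ (x = y' /\ y = x').
Proof. by rewrite /edge; do 2!case: ifP => _; case=> -> ->; tauto. Qed.

Lemma edge_pairs x y : x != y -> edge x y \in pairs n.
Proof. by rewrite -val_eqE /edge; case: ltngtP => // lt_xy _; rewrite inE. Qed.

Lemma edge_adj E x y : edge x y \in E -> adj E x y.
Proof. by rewrite /edge /adj; case: ifP => _ ->; rewrite ?orbT. Qed.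

Definition cycle_edges k (s : 'I_k -> 'I_n) : {set 'I_n * 'I_n} :=
  [set edge (s i) (s (ordS i)) | i : 'I_k].

Section Cycle.
Variables (k : nat) (s : 'I_k -> 'I_n).
Hypotheses (k_gt2 : (2 < k)%N) (inj_s : injective s).

(** An edge met at two indices would be traversed in opposite directions, so two rotations would fix
    an index, impossible for [2 < k]. *)
Lemma cycle_edge_inj : injective (fun i => edge (s i) (s (ordS i))).
Proof.
move=> i j /edge_inj[[/inj_s//]|[/inj_s-> /inj_s/eqP]].
by rewrite (negPf (ordS2_neq _ k_gt2)).
Qed.

Lemma card_cycle_edges : #|cycle_edges s| = k.
Proof. by rewrite card_imset ?card_ord //; exact: cycle_edge_inj. Qed.

Lemma cycle_edges_pairs : cycle_edges s \subset pairs n.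
Proof.
apply/subsetP=> _ /imsetP[i _ ->]; apply: edge_pairs.
by rewrite (inj_eq inj_s) eq_sym ordS_neq // ltnW.
Qed.

End Cycle.

Lemma mem_cycle_edges k (s : 'I_k -> 'I_n) x y : edge x y \in cycle_edges s ->
  exists j, (x = s j /\ y = s (ordS j)) \/ (x = s (ordS j) /\ y = s j).
Proof. by case/imsetP=> j _ /edge_inj; exists j. Qed.

(** * Intersections of two cycles *)

Section TwoCycles.
Variables (k l : nat) (s : 'I_k -> 'I_n) (t : 'I_l -> 'I_n).
Hypotheses (k_gt2 : (2 < k)%N) (l_gt2 : (2 < l)%N).
Hypotheses (inj_s : injective s) (inj_t : injective t).

(* A vertex of t outside s makes both t-edges at it new, so the new edges are at
   least as many as the new vertices; equality would make the set of new
   vertices invariant under the rotation of t. *)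
Lemma card_cycle_edgesD :
  ~~ (cycle_edges t \subset cycle_edges s) ->
  ~~ [disjoint cycle_edges t & cycle_edges s] ->
  (#|[set i | t i \notin codom s]| < #|cycle_edges t :\: cycle_edges s|)%N.
Proof.
move=> not_sub not_disj; pose e i := edge (t i) (t (ordS i)).
set U := [set i | _].
have -> : cycle_edges t :\: cycle_edges s = e @: [set i | e i \notin cycle_edges s].
  apply/setP=> z; rewrite inE; apply/andP/imsetP.
    by case=> zs /imsetP[i _ def_z]; exists i; rewrite ?inE /e -?def_z.
  by case=> i; rewrite inE => eis ->; split; rewrite // imset_f.
rewrite card_imset; last exact: cycle_edge_inj.
set B := [set i | e i \notin _].
have mem_s i : e i \in cycle_edges s -> (t i \in codom s) && (t (ordS i) \in codom s).
  by case/mem_cycle_edges=> j [] [-> ->]; rewrite !codom_f.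
have subUB : U \subset B.
  by apply/subsetP=> i; rewrite !inE; apply: contra => /mem_s/andP[].
apply: proper_card; rewrite properE subUB; apply: contra not_disj => subBU.
have UP i : ordS i \in U -> i \in U.
  by move=> iU; apply: (subsetP subBU); move: iU; rewrite !inE; apply: contra => /mem_s/andP[].
case/subsetPn: not_sub => _ /imsetP[i0 _ ->] i0B.
have i0U : i0 \in U by apply: (subsetP subBU); rewrite inE.
(* [U] is closed under predecessors, so its complement is closed under [ordS] and would reach [i0]
   if it were nonempty. *)
have allU i : i \in U.
  apply: contraT => iU; suff : i0 \notin U by rewrite i0U.
  by apply: (@ordS_ind _ (fun i => i \notin U) i) => // j; apply: contra; exact: UP.
rewrite disjoint_subset; apply/subsetP=> _ /imsetP[i _ ->].
by move: (subsetP subUB _ (allU i)); rewrite !inE.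
Qed.

(** The position [u i] of [t i] on [s] moves by one step at a time and, being injective, never turns
    back. Its image is closed under that step, hence is all of ['I_k]. *)
Lemma cycle_edges_sub : cycle_edges t \subset cycle_edges s ->
  k = l /\ exists j (b : bool),
    forall i, t i = s (iter i (if b then @ordS k else @ord_pred k) j).
Proof.
move=> sub_ts.
have t_s i : exists j, (t i = s j /\ t (ordS i) = s (ordS j)) \/
                       (t i = s (ordS j) /\ t (ordS i) = s j).
  by apply/mem_cycle_edges/(subsetP sub_ts)/imset_f.
have t_codom i : t i \in codom s.
  by have [j [[-> _]|[-> _]]] := t_s i; exact: codom_f.
pose u i := iinv (t_codom i).
have uK i : s (u i) = t i by exact: f_iinv.
have inj_u : injective u by move=> i j eq_u; apply: inj_t; rewrite -!uK eq_u.
have u_dir i : (u (ordS i) == ordS (u i)) || (u (ordS i) == ord_pred (u i)).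
  have [j] := t_s i; rewrite -!uK.
  case=> [] [/inj_s-> /inj_s->]; first by rewrite eqxx.
  by rewrite ordSK eqxx orbT.
have [b ub] : exists b : bool, forall i,
    u (ordS i) = (if b then @ordS k else @ord_pred k) (u i).
  case: (pickP (fun i => u (ordS i) == ordS (u i))) => [i0 ui0 | no_up].
    exists true => i; apply/eqP.
    apply: (ordS_ind (P := fun i => u (ordS i) == ordS (u i)) ui0) => j /eqP uj.
    (* Turning back would give [u (ordS (ordS j)) = u j], against injectivity. *)
    have /orP[//|/eqP] := u_dir (ordS j); rewrite uj ordSK => /inj_u/eqP.
    by rewrite (negPf (ordS2_neq _ l_gt2)).
  by exists false => i; have := u_dir i; rewrite no_up => /eqP.
have l_gt0 : (0 < l)%N by lia.
pose o := Ordinal l_gt0.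
have u_iter i : u i = iter i (if b then @ordS k else @ord_pred k) (u o).
  have -> : u i = u (iter i (@ordS l) o).
    by congr u; apply: val_inj; rewrite /= val_iter_ordS add0n modn_small.
  by elim: (i : nat) => //= m IHm; rewrite ub IHm.
split; last by exists (u o), b => i; rewrite -uK u_iter.
apply/eqP; rewrite eqn_leq; apply/andP; split; last first.
  by have := leq_card u inj_u; rewrite !card_ord.
rewrite -[l]card_ord -[k]card_ord -(card_codom inj_u); apply/subset_leq_card/subsetP => j _.
have uS j' : j' \in codom u -> (if b then @ordS k else @ord_pred k) j' \in codom u.
  by case/codomP=> i ->; rewrite -ub codom_f.
case: (b) uS => uS.
  by apply: (ordS_ind (P := mem (codom u)) (codom_f u o)) => j'; exact: uS.
(* In the backward direction it is the complement of the image that is closed under [ordS]. *)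
apply: contraT => ju; have /negP[] : u o \notin codom u; last exact: codom_f.
apply: (ordS_ind (P := fun j => j \notin codom u) ju) => j'; apply: contra => /uS.
by rewrite ordSK.
Qed.
End TwoCycles.

(** By [cycle_edges_sub], such a [t] is determined by its starting point on [s] and its
    direction. *)
Lemma card_cycle_edges_sub k l (s : 'I_k -> 'I_n) :
  (2 < k)%N -> (2 < l)%N -> injective s ->
  (#|[set t : {ffun 'I_l -> 'I_n} | injectiveb t && (cycle_edges t \subset cycle_edges s)]|
   <= (k == l) * (2 * k))%N.
Proof.
move=> k_gt2 l_gt2 inj_s; case: eqP => [eq_kl | neq_kl]; last first.
  rewrite mul0n leqn0 cards_eq0; apply/eqP/setP=> t; rewrite !inE.
  apply/negP=> /andP[/injectiveP inj_t /cycle_edges_sub[] //].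
rewrite mul1n.
pose h (jb : 'I_k * bool) : {ffun 'I_l -> 'I_n} :=
  [ffun i : 'I_l => s (iter i (if jb.2 then @ordS k else @ord_pred k) jb.1)].
apply: (@leq_trans #|h @: [set: 'I_k * bool]|).
  apply/subset_leq_card/subsetP=> t; rewrite inE => /andP[/injectiveP inj_t].
  case/cycle_edges_sub=> // _ [j [b def_t]]; apply/imsetP; exists (j, b) => //.
  by apply/ffunP=> i; rewrite ffunE def_t.
by rewrite (leq_trans (leq_imset_card _ _)) // cardsT card_prod card_ord card_bool mulnC.
Qed.
End Edges.

(** * Falling factorials against powers *)

Lemma leq_ffact_expn n k : (n ^_ k <= n ^ k)%N.
Proof.
rewrite ffact_prod -[X in (_ <= _ ^ X)%N](card_ord k) -prod_nat_const.
by apply: leq_prod => i _; exact: leq_subr.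
Qed.

(** The relative error of [n ^_ k] against [n ^ k] is at most [k ^ 2 / n], stated without division
    or subtraction. *)
Lemma leq_expn_ffact n k : (n * n ^ k <= n * n ^_ k + k ^ 2 * n ^ k)%N.
Proof.
elim: k => [|k IHk]; first by rewrite expn0 ffactn0; lia.
have le_ffact := leq_ffact_expn n k.
rewrite ffactnSr expnS; have [lt_nk | le_kn] := ltnP n k.
  apply: (@leq_trans (n * (k.+1 ^ 2 * n ^ k))); last by nia.
  rewrite leq_mul2l leq_mul2r; apply/orP; right; apply/orP; right; nia.
have := leq_mul2l n (n * n ^ k) (n * n ^_ k + k ^ 2 * n ^ k); rewrite IHk orbT.
have [d ->] : exists d, n = (k + d)%N by exists (n - k)%N; lia.
rewrite addKn; nia.
Qed.

(** * The second moment of the number of odd cycles *)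

Section Mean.
Variables (R : realFieldType) (n : nat) (p : R).

Definition gnp_mean (X : {set 'I_n * 'I_n} -> R) : R :=
  \sum_(E in powerset (pairs n)) X E * (p ^+ #|E| * (1 - p) ^+ (#|pairs n| - #|E|)).

Lemma eq_gnp_mean X Y : X =1 Y -> gnp_mean X = gnp_mean Y.
Proof. by move=> eqXY; apply: eq_bigr => E _; rewrite eqXY. Qed.

Lemma gnp_meanD X Y : gnp_mean (fun E => X E + Y E) = gnp_mean X + gnp_mean Y.
Proof. by rewrite /gnp_mean -big_split; apply: eq_bigr => E _ /=; rewrite mulrDl. Qed.

Lemma gnp_meanZ a X : gnp_mean (fun E => a * X E) = a * gnp_mean X.
Proof. by rewrite /gnp_mean mulr_sumr; apply: eq_bigr => E _; rewrite -mulrA. Qed.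

Lemma gnp_mean_sum (I : finType) (P : pred I) (X : I -> {set 'I_n * 'I_n} -> R) :
  gnp_mean (fun E => \sum_(i | P i) X i E) = \sum_(i | P i) gnp_mean (X i).
Proof.
by rewrite /gnp_mean exchange_big; apply: eq_bigr => E _; rewrite mulr_suml.
Qed.

Lemma gnp_mean_sub (A : {set 'I_n * 'I_n}) : A \subset pairs n ->
  gnp_mean (fun E => (A \subset E)%:R) = p ^+ #|A|.
Proof.
move=> sAD; set D := pairs n in sAD *.
(* Expanding the product of the [F i + G i] gives a sum over all sets [E]. As [F] vanishes off [D]
   and [G] vanishes on [A], only those between [A] and [D] survive. *)
pose F (i : 'I_n * 'I_n) := if i \in D then p else 0.
pose G i := if i \in A then 0 else if i \in D then 1 - p else 1.
have -> : p ^+ #|A| = \prod_i (F i + G i).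
  rewrite (bigID (mem A)) /= [X in _ * X]big1 ?mulr1 => [|i iA]; last first.
    by rewrite /F /G (negPf iA); case: ifP => _; rewrite ?add0r // addrC subrK.
  rewrite -prodr_const; apply: eq_bigr => i iA.
  by rewrite /F /G iA (subsetP sAD) ?addr0.
rewrite (bigA_distr _ _ F G) (bigID (mem (powerset D))) /= [X in _ + X]big1 ?addr0; last first.
  move=> E; rewrite inE => /subsetPn[i iE iD].
  by rewrite (bigD1 i) //= iE /F (negPf iD) mul0r.
rewrite /gnp_mean; apply: eq_big => E; rewrite ?inE // => sED.
case: (boolP (A \subset E)) => [sAE | /subsetPn[i iA iE]]; last first.
  by rewrite mul0r (bigD1 i) //= (negPf iE) /G iA mul0r.
rewrite mul1r (bigID (mem E)) /=; congr (_ * _).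
  rewrite -prodr_const; apply: eq_bigr => i iE.
  by rewrite iE /F (subsetP sED).
rewrite (bigID (mem D)) /= [X in _ * X]big1 ?mulr1 => [|i /andP[iE iD]]; last first.
  by rewrite (negPf iE) /G (negPf iD) (negPf (contra (subsetP sAE i) iE)).
have -> : (#|pairs n| - #|E| = #|D :\: E|)%N by rewrite cardsD (setIidPr sED).
rewrite -prodr_const; apply: eq_big => i; first by rewrite in_setD.
case/setDP=> iD iE.
by rewrite (negPf iE) /G iD (negPf (contra (subsetP sAE i) iE)).
Qed.

Lemma gnp_mean_cst a : gnp_mean (fun=> a) = a.
Proof.
rewrite -[RHS]mulr1 -[X in _ * X](expr0 p) -(cards0 ('I_n * 'I_n)%type) -gnp_mean_sub ?sub0set //.
by rewrite -gnp_meanZ; apply: eq_bigr => E _; rewrite sub0set mulr1.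
Qed.

Hypothesis p01 : 0 <= p <= 1.

Lemma ler_gnp_mean X Y : (forall E, X E <= Y E) -> gnp_mean X <= gnp_mean Y.
Proof.
case/andP: p01 => p_ge0 p_le1 leXY; apply: ler_sum => E _.
by rewrite ler_wpM2r // mulr_ge0 ?exprn_ge0 ?subr_ge0.
Qed.

(* The three terms bound the t edge-disjoint from s, the t with no new edge, and
   the others, for which [card_cycle_edgesD] saves a factor p. *)
Lemma sum_cycle_edgesD k l (s : 'I_k -> 'I_n) :
  (2 < k)%N -> (2 < l)%N -> injective s ->
  \sum_(t : {ffun 'I_l -> 'I_n} | injectiveb t) p ^+ #|cycle_edges t :\: cycle_edges s|
  <= (n%:R * p) ^+ l + ((k == l) * (2 * k))%:R + p * (k%:R + n%:R * p) ^+ l.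
Proof.
move=> k_gt2 l_gt2 inj_s; case/andP: p01 => p_ge0 p_le1.
(* Charging [p] for each vertex of [t] outside [s] makes the bound a product over the vertices, so
   its sum over all maps [t] is a power of the sum of [q]. *)
pose q (x : 'I_n) : R := if x \in codom s then 1 else p.
have q_ge0 x : 0 <= q x by rewrite /q; case: ifP.
pose B (t : {ffun 'I_l -> 'I_n}) := cycle_edges t \subset cycle_edges s.
apply: (@le_trans _ _ (\sum_(t : {ffun 'I_l -> 'I_n} | injectiveb t)
    (p ^+ l + (B t)%:R + p * \prod_i q (t i)))).
  apply: ler_sum => t /injectiveP inj_t.
  have pq_ge0 : 0 <= p * \prod_i q (t i) by rewrite mulr_ge0 ?prodr_ge0.
  case: (boolP (B t)) => Bt.
    apply: (@le_trans _ _ 1); first by rewrite exprn_ile1.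
    by rewrite addrAC lerDr addr_ge0 ?exprn_ge0.
  rewrite addr0; case: (boolP [disjoint cycle_edges t & cycle_edges s]) => dis.
    by rewrite (setDidPl _) // card_cycle_edges // lerDl.
  apply: ler_wpDl; first exact: exprn_ge0.
  have lt_card := card_cycle_edgesD l_gt2 inj_t Bt dis.
  apply: (le_trans (ler_wiXn2l _ _ lt_card)) => //.
  rewrite exprS ler_wpM2l // -prodr_const big_mkcond /=.
  apply: ler_prod => i _; by rewrite inE /q; case: (t i \in codom s); rewrite /= ?p_ge0 ?ler01 lexx.
rewrite big_split /= big_split /=; apply: lerD; first apply: lerD.
- apply: (@le_trans _ _ (\sum_(t : {ffun 'I_l -> 'I_n}) p ^+ l)).
    by rewrite [leRHS](bigID (fun t : {ffun _} => injectiveb t)) /=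
      lerDl sumr_ge0 // => t _; rewrite exprn_ge0.
  by rewrite sumr_const card_ffun !card_ord exprMn -natrX mulr_natl.
- rewrite -natr_sum ler_nat -big_mkcondr sum1_card /=.
  apply: leq_trans (card_cycle_edges_sub k_gt2 l_gt2 inj_s).
  by rewrite cardsE.
- rewrite -mulr_sumr ler_wpM2l //.
  apply: (@le_trans _ _ (\sum_(t : {ffun 'I_l -> 'I_n}) \prod_i q (t i))).
    by rewrite [leRHS](bigID (fun t : {ffun _} => injectiveb t)) /=
      lerDl sumr_ge0 // => t _; rewrite prodr_ge0.
  rewrite -(bigA_distr_bigA (fun=> q)) prodr_const card_ord.
  rewrite lerXn2r ?nnegrE ?sumr_ge0 // ?addr_ge0 ?mulr_ge0 //.
  rewrite (bigID (mem (codom s))) /=; apply: lerD.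
    rewrite (eq_bigr (fun=> 1)) => [|x]; last by rewrite /q => ->.
    by rewrite sumr_const card_codom ?card_ord.
  rewrite (eq_bigr (fun=> p)) => [|x]; last by rewrite /q => /negPf->.
  rewrite sumr_const -[leLHS]mulr_natl ler_wpM2r // ler_nat.
  by rewrite -[leqRHS]card_ord max_card.
Qed.
End Mean.

(** The odd lengths start at 3, the length of the shortest cycle. *)
Definition oddlen m := m.*2.+3.

Definition has_odd_cycle M n (E : {set 'I_n * 'I_n}) : bool :=
  [exists m : 'I_M, [exists s : {ffun 'I_(oddlen m) -> 'I_n},
     injectiveb s && (cycle_edges s \subset E)]].

(** * Chebyshev's inequality for the weighted count of odd cycles *)

Section SecondMoment.
Variables (R : realFieldType) (c : R) (n M : nat).
Hypotheses (c_ge1 : 1 <= c) (n_gt0 : (0 < n)%N) (c_le_n : c <= n%:R).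

Local Notation p := (c / n%:R).

Definition odd_harmonic : R := \sum_(m < M) (oddlen m)%:R^-1.
Local Notation H := odd_harmonic.

(* The weight makes each length k contribute about 1/k to the mean, for every c. *)
Definition cycle_weight m : R := (c ^+ oddlen m)^-1 / (oddlen m)%:R.

(** A cycle of length k is counted 2k times, once for each starting vertex and direction. *)
Definition odd_cycle_count (E : {set 'I_n * 'I_n}) : R :=
  \sum_(m < M) cycle_weight m *
    \sum_(s : {ffun 'I_(oddlen m) -> 'I_n} | injectiveb s)
      (cycle_edges s \subset E)%:R.
Local Notation X := odd_cycle_count.

Let c_gt0 : 0 < c. Proof. exact: lt_le_trans ltr01 c_ge1. Qed.
Let n0 : 0 < n%:R :> R. Proof. by rewrite ltr0n. Qed.
Let p01 : 0 <= p <= 1.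
Proof. by apply/andP; split; [rewrite divr_ge0 // ltW | rewrite ler_pdivrMr // mul1r]. Qed.
Let p_ge0 : 0 <= p. Proof. by case/andP: p01. Qed.
Let np : n%:R * p = c. Proof. by rewrite mulrC divfK ?gt_eqF. Qed.
Let weight_ge0 m : 0 <= cycle_weight m.
Proof. by rewrite divr_ge0 // invr_ge0 exprn_ge0 // ltW. Qed.
Let weightE m : cycle_weight m * c ^+ oddlen m = (oddlen m)%:R^-1.
Proof. by rewrite mulrAC mulVf ?mul1r // expf_neq0 // gt_eqF. Qed.
Let weight_le m : cycle_weight m * (oddlen m)%:R <= 1.
Proof.
by rewrite divfK ?pnatr_eq0 // invf_le1 ?exprn_gt0 // exprn_ege1.
Qed.
Let weight_le1 m : cycle_weight m <= 1.
Proof.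
by apply: le_trans (weight_le m); rewrite ler_peMr // ler1n.
Qed.
Let H_ge0 : 0 <= H. Proof. by apply: sumr_ge0 => m _; rewrite invr_ge0. Qed.

(** Since [n%:R * p = c], the weight cancels the power of [c] and leaves [n ^_ k / n ^ k] divided by
    k, which [leq_expn_ffact] bounds from below. *)
Lemma weight_injections m :
  (oddlen m)%:R^-1 - (oddlen m)%:R / n%:R <=
  cycle_weight m * \sum_(s : {ffun 'I_(oddlen m) -> 'I_n} | injectiveb s) p ^+ oddlen m
  <= (oddlen m)%:R^-1.
Proof.
set k := oddlen m; have k_gt0 : 0 < k%:R :> R by rewrite ltr0n.
have low j : n%:R * n%:R ^+ j <= n%:R * (n ^_ j)%:R + j%:R ^+ 2 * n%:R ^+ j :> R.
  by rewrite -!natrX -!natrM -natrD ler_nat leq_expn_ffact.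
have up j : (n ^_ j)%:R <= n%:R ^+ j :> R.
  by rewrite -natrX ler_nat leq_ffact_expn.
have -> : \sum_(s : {ffun 'I_k -> 'I_n} | injectiveb s) p ^+ k = (n ^_ k)%:R * p ^+ k.
  rewrite sumr_const mulr_natl; congr (_ *+ _).
  by have := card_inj_ffuns 'I_k 'I_n; rewrite !card_ord cardsE => <-.
have nk0 : 0 < n%:R ^+ k :> R by rewrite exprn_gt0.
have -> : cycle_weight m * ((n ^_ k)%:R * p ^+ k) = k%:R^-1 * ((n ^_ k)%:R / n%:R ^+ k).
  by rewrite -[in RHS](weightE m) expr_div_n -/k; ring.
apply/andP; split; last by rewrite ler_piMr ?invr_ge0 // ler_pdivrMr // mul1r.
have -> : k%:R^-1 - k%:R / n%:R = k%:R^-1 * (1 - k%:R ^+ 2 / n%:R) :> R.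
  by field; rewrite ?gt_eqF.
rewrite ler_pM2l ?invr_gt0 // ler_pdivlMr // -(ler_pM2l n0).
have -> : n%:R * ((1 - k%:R ^+ 2 / n%:R) * n%:R ^+ k) =
    n%:R * n%:R ^+ k - k%:R ^+ 2 * n%:R ^+ k :> R by field; rewrite gt_eqF.
by rewrite lerBlDr.
Qed.

Let p_mean m (s : {ffun 'I_(oddlen m) -> 'I_n}) : injectiveb s ->
  gnp_mean p (fun E => (cycle_edges s \subset E)%:R) = p ^+ oddlen m.
Proof.
move/injectiveP=> inj_s.
by rewrite gnp_mean_sub ?cycle_edges_pairs // card_cycle_edges.
Qed.

Lemma mean_count_ge : H - (M * oddlen M)%:R / n%:R <= gnp_mean p X.
Proof.
rewrite gnp_mean_sum.
under eq_bigr => m _.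
  rewrite gnp_meanZ gnp_mean_sum (eq_bigr (fun=> p ^+ oddlen m)); last by move=> s; exact: p_mean.
  over.
apply: (@le_trans _ _ (\sum_(m < M) ((oddlen m)%:R^-1 - (oddlen m)%:R / n%:R))).
  rewrite sumrB lerD2l lerN2 -mulr_suml ler_wpM2r ?invr_ge0 // -natr_sum ler_nat.
  rewrite -[X in (_ <= X * _)%N]card_ord -sum_nat_const; apply: leq_sum => m _.
  by rewrite /oddlen; have := ltn_ord m; lia.
by apply: ler_sum => m _; case/andP: (weight_injections m).
Qed.

(** A bound, independent of [n], for the last term of [sum_cycle_edgesD] summed over the [M]
    lengths. *)
Let D : R := M%:R * ((oddlen M)%:R + c) ^+ oddlen M.
Let D_ge0 : 0 <= D.
Proof. by rewrite mulr_ge0 // exprn_ge0 // addr_ge0 // ltW. Qed.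

(** Given that [s] is present, [t] is present with probability p to the number of its new edges. In
    the sum over [t], disjoint cycles give [H], the copies of [s] give 2, and the other cycles give
    [p * D]. *)
Lemma mean_count_cycle m (s : {ffun 'I_(oddlen m) -> 'I_n}) : (m < M)%N -> injectiveb s ->
  gnp_mean p (fun E => (cycle_edges s \subset E)%:R * X E) <= p ^+ oddlen m * (H + 2 + p * D).
Proof.
move=> lt_mM /injectiveP inj_s.
under eq_gnp_mean => E.
  rewrite mulr_sumr; under eq_bigr => m' _.
    rewrite mulrCA mulr_sumr; under eq_bigr => t _ do rewrite -natrM mulnb -subUset.
    over.
  over.
rewrite gnp_mean_sum; under eq_bigr => m' _.
  rewrite gnp_meanZ gnp_mean_sum.
  rewrite (eq_bigr (fun t : {ffun 'I_(oddlen m') -> 'I_n} =>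
      p ^+ oddlen m * p ^+ #|cycle_edges t :\: cycle_edges s|)); last first.
    move=> t /injectiveP inj_t.
    rewrite gnp_mean_sub ?subUset ?cycle_edges_pairs //.
    rewrite -exprD; congr (p ^+ _).
    rewrite -[X in _ = (X + _)%N](card_cycle_edges (isT : 2 < oddlen m)%N inj_s).
    rewrite cardsU cardsD setIC addnBA //.
    exact: subset_leq_card (subsetIl _ _).
  rewrite -mulr_sumr mulrCA; over.
rewrite -mulr_sumr ler_wpM2l ?exprn_ge0 //.
apply: (@le_trans _ _ (\sum_(m' < M) ((oddlen m')%:R^-1
    + (if m' == Ordinal lt_mM then 2 else 0) + p * ((oddlen M)%:R + c) ^+ oddlen M))).
  apply: ler_sum => m' _.
  have := sum_cycle_edgesD p01 (isT : 2 < oddlen m)%N (isT : 2 < oddlen m')%N inj_s.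
  rewrite np => /(ler_wpM2l (weight_ge0 m'))/le_trans; apply.
  rewrite !mulrDr weightE; apply: lerD; first apply: lerD => //.
    (* The 2k parametrisations of the cycle [s] weigh at most 2 in total, because k times the weight
       is [c ^- k], and [1 <= c]. *)
    rewrite -val_eqE /=; have [eq_m|neq_m] := eqVneq (m' : nat) m.
      rewrite eq_m eqxx mul1n natrM mulrCA -[leRHS]mulr1 ler_wpM2l //; exact: weight_le.
    rewrite (_ : (oddlen m == oddlen m') = false) ?mul0n ?mulr0 //.
    by apply/eqP; move/eqP: neq_m; rewrite /oddlen; lia.
  rewrite -[leRHS]mul1r; apply: ler_pM => //.
    by rewrite mulr_ge0 // exprn_ge0 // addr_ge0 // ltW.
  rewrite ler_wpM2l //.
  have leK : (oddlen m' <= oddlen M)%N by have := ltn_ord m'; rewrite /oddlen; lia.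
  apply: (@le_trans _ _ (((oddlen M)%:R + c) ^+ oddlen m')).
    apply: lerXn2r; try by rewrite nnegrE addr_ge0 // ltW.
    by rewrite lerD2r ler_nat /oddlen; lia.
  by rewrite ler_weXn2l // (le_trans c_ge1) // lerDr.
rewrite !big_split /= -big_mkcond big_pred1_eq sumr_const card_ord.
by rewrite -[_ *+ M]mulr_natl [p * D]mulrCA.
Qed.

Lemma mean_count2 : gnp_mean p (fun E => X E * X E) <= H * (H + 2 + p * D).
Proof.
under eq_gnp_mean => E.
  rewrite [X in X * _]/odd_cycle_count mulr_suml; under eq_bigr => m _.
    rewrite -mulrA mulr_suml; over.
  over.
rewrite gnp_mean_sum mulr_suml; apply: ler_sum => m _; rewrite gnp_meanZ gnp_mean_sum.
have HD_ge0 : 0 <= H + 2 + p * D.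
  by apply: addr_ge0; [rewrite addr_ge0 | exact: mulr_ge0].
case/andP: (weight_injections m) => _ /(ler_wpM2r HD_ge0); apply: le_trans.
rewrite -[leRHS]mulrA ler_wpM2l // mulr_suml; apply: ler_sum => s; exact: mean_count_cycle.
Qed.

Lemma no_odd_cycle_count E : ~~ has_odd_cycle M E -> X E = 0.
Proof.
move=> noE; apply: big1 => m _; rewrite big1 ?mulr0 // => s inj_s.
case: (boolP (_ \subset E)) => // sub_s; case/negP: noE.
by apply/existsP; exists m; apply/existsP; exists s; rewrite inj_s.
Qed.

(* Chebyshev's inequality around [H], the approximate mean of the count. *)
Lemma mean_no_odd_cycle :
  gnp_mean p (fun E : {set 'I_n * 'I_n} => (~~ has_odd_cycle M E)%:R) * H ^+ 2 <=
  H * (2 + (c * D + 2 * (M * oddlen M)%:R) / n%:R).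
Proof.
rewrite mulrC -gnp_meanZ.
(* The majorant is the expanded square of [X E - H]: it is nonnegative, and equals [H ^+ 2] when the
   count vanishes. *)
apply: (@le_trans _ _ (gnp_mean p (fun E => X E * X E + ((- 2 * H) * X E + H ^+ 2)))).
  apply: ler_gnp_mean => // E; case: (boolP (has_odd_cycle M E)) => [_ | noE].
    by rewrite mulr0; have := sqr_ge0 (X E - H); rewrite sqrrB; nra.
  by rewrite no_odd_cycle_count // !mulr0 !add0r mulr1.
rewrite !gnp_meanD gnp_meanZ gnp_mean_cst.
have := mean_count2; have /(ler_wpM2l H_ge0) := mean_count_ge.
rewrite [_ / n%:R * D]mulrAC; set q := n%:R^-1.
by move=> ? ?; lra.
Qed.

End SecondMoment.

Lemma has_odd_cycle_disconnected M n (E : {set 'I_n * 'I_n}) :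
  colorable 3 E -> has_odd_cycle M E -> hom_disconnected (adj E) K3.
Proof.
case/existsP=> f /forallP col_f /existsP[m /existsP[s /andP[_ /subsetP sub_s]]].
apply: (hom_disconnected_odd_walk (s := s) _ (f := f)).
- by move=> i; apply/edge_adj/sub_s/imset_f.
- by rewrite /= !negbK odd_double.
- by move=> x y xy; move: (col_f x) => /forallP/(_ y)/implyP/(_ xy).
Qed.

(** * Asymptotics *)

From mathcomp Require Import all_classical all_reals all_analysis.
Import Order.TTheory GRing.Theory Num.Theory.
Import numFieldNormedType.Exports.
Local Open Scope classical_set_scope.

Lemma gnp_probE (R : realType) n (p : R) (P : pred {set 'I_n * 'I_n}) :
  gnp_prob n p P = gnp_mean p (fun E => (P E)%:R).
Proof.
rewrite /gnp_prob big_mkcondr; apply: eq_bigr => E _.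
by case: (P E); rewrite ?mul1r ?mul0r.
Qed.

Lemma odd_harmonic_unbounded (R : realType) (B : R) : exists M, B < odd_harmonic R M.
Proof.
apply: contrapT => noM; apply: (@dvg_harmonic R).
apply: nondecreasing_is_cvgn.
  by apply: nondecreasing_series => k _ _; rewrite invr_ge0.
exists (3 * B) => _ [M _ <-].
have {noM} leB : odd_harmonic R M <= B by rewrite leNgt; apply/negP => ?; apply: noM; exists M.
(* The factor 3 comes from [2m + 3 <= 3(m + 1)], a termwise comparison with the harmonic series. *)
apply: le_trans (_ : 3 * odd_harmonic R M <= _); last by rewrite ler_pM2l.
rewrite /series /= big_mkord mulr_sumr; apply: ler_sum => m _.
rewrite /harmonic ler_pdivlMr ?ltr0n // mulrC ler_pdivrMr ?ltr0n //.
by rewrite -natrM ler_nat /oddlen; lia.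
Qed.

Lemma lt_limn_einf_eventually (R : realType) (d : nat -> R) (c : R) :
  (c%:E < limn_einf (fun n => (d n)%:E))%E ->
  exists2 r, c < r & exists N, forall n, (N <= n)%N -> r <= d n.
Proof.
rewrite limn_einf_lim.
have /ereal_nondecreasing_cvgn/cvg_lim -> // := @nondecreasing_einfs _ (fun n => (d n)%:E).
case/ereal_sup_gt => _ [N _ <-] lt_c.
have le_d n : (N <= n)%N -> (einfs (fun n => (d n)%:E) N <= (d n)%:E)%E.
  by move=> le_Nn; apply: ereal_inf_lbound; exists n.
(* The tail infimum is the required [r]; it is not infinite, being above [c] and at most [d N]. *)
case: (einfs _ N) lt_c le_d => [r| |] //= lt_c le_d.
- by exists r; rewrite -?lte_fin //; exists N => n /le_d; rewrite lee_fin.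
- by have := le_d N (leqnn N).
Qed.

Theorem theorem5p3 (R : realType) (d : nat -> R) :
  sharp_threshold3 d ->
  forall c : R, 1 <= c ->
    (c%:E < limn_einf (fun n => (d n)%:E))%E ->
    (fun n : nat => gnp_prob n (c / n%:R) (fun E => hom_disconnected (adj E) K3))
      @ \oo --> (1 : R).
Proof.
move=> thr c c_ge1 /lt_limn_einf_eventually[r lt_cr [N0 le_rd]].
have c_gt0 : 0 < c by apply: lt_le_trans c_ge1.
have r_gt0 : 0 < r by apply: lt_trans lt_cr.
(* Chosen so that [(1 - eps) * r] is the midpoint of [c] and [r]. *)
pose eps := (r - c) / (2 * r).
have eps_gt0 : 0 < eps by rewrite divr_gt0 ?subr_gt0 ?mulr_gt0.
have epsr : (1 - eps) * r = (r + c) / 2 by rewrite /eps; field; rewrite gt_eqF.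
have eps_lt1 : 0 < 1 - eps by rewrite -(pmulr_lgt0 _ r_gt0) epsr; lra.
have ev_c : eventually_P (fun n => c < (1 - eps) * d n).
  exists N0 => n /le_rd; rewrite -(ler_pM2l eps_lt1); apply: lt_le_trans.
  by rewrite epsr; lra.
have /cvgrPdist_lt col := (thr eps eps_gt0 c c_gt0).1 ev_c.
apply/cvgrPdist_lt => e e_gt0.
(* This makes [H * (e / 2)] exceed 4, while Chebyshev's bound will give [no_odd * H <= 3] once [n]
   is at least [K]. *)
have [M ltM] := odd_harmonic_unbounded (8 / e + 1).
set H := odd_harmonic R M in ltM.
have H_gt0 : 0 < H by apply: lt_trans ltM; rewrite addr_gt0 ?divr_gt0.
pose K := c * (M%:R * ((oddlen M)%:R + c) ^+ oddlen M) + 2 * (M * oddlen M)%:R.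
have e2_gt0 : 0 < e / 2 by rewrite divr_gt0.
near=> n.
have n_gt0 : (0 < n)%N by near: n; exact: nbhs_infty_gt.
have le_cn : c <= n%:R by near: n; exact: nbhs_infty_ger.
have le_Kn : K <= n%:R by near: n; exact: nbhs_infty_ger.
have col_n : `|1 - gnp_prob n (c / n%:R) (fun E => colorable 3 E)| < e / 2.
  by near: n; exact: col.
have n_gt0R : 0 < n%:R :> R by rewrite ltr0n.
have p01 : 0 <= c / n%:R <= 1.
  by rewrite divr_ge0 ?(ltW c_gt0) //= ler_pdivrMr // mul1r.
have := mean_no_odd_cycle M c_ge1 n_gt0 le_cn.
set no_odd := gnp_mean _ _; rewrite -/H -/K => odd_n.
have {odd_n} odd_n : no_odd < e / 2.
  have KH : K / n%:R <= 1 by rewrite ler_pdivrMr // mul1r.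
  have : no_odd * H <= 3.
    by rewrite -(ler_pM2l H_gt0); apply: le_trans (_ : H * (2 + K / n%:R) <= _);
       [rewrite mulrCA -expr2 | rewrite ler_pM2l //; lra].
  move: ltM; rewrite -(ltr_pM2r e2_gt0) mulrDl.
  have -> : 8 / e * (e / 2) = 4 by field; rewrite gt_eqF.
  by rewrite mul1r => ltM noH; rewrite -(ltr_pM2r H_gt0); lra.
have le1 : gnp_prob n (c / n%:R) (fun E => hom_disconnected (adj E) K3) <= 1.
  rewrite gnp_probE -[leRHS](gnp_mean_cst n (c / n%:R)).
  by apply: ler_gnp_mean => // E; rewrite lern1; case: (hom_disconnected _ _).
(* Union bound: a 3-colourable graph has a disconnected complex or has no odd cycle among the first
   [M] odd lengths. *)
have : gnp_prob n (c / n%:R) (fun E => colorable 3 E) <=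
    gnp_prob n (c / n%:R) (fun E => hom_disconnected (adj E) K3) + no_odd.
  rewrite !gnp_probE -gnp_meanD; apply: ler_gnp_mean => // E.
  case: (boolP (has_odd_cycle M E)) => oddE; last by rewrite ler_wpDl //= lern1 leq_b1.
  case: (boolP (colorable 3 E)) => [colE|_]; last by rewrite addr_ge0.
  by rewrite (has_odd_cycle_disconnected colE oddE) lerDl.
move: col_n; rewrite ltr_norml => /andP[_ col_n] le_col; rewrite ger0_norm ?subr_ge0 //; lra.
Unshelve. all: by end_near.
Qed.
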